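(* Given an $n\times n$ matrix $A$ with entries from a totally ordered set, one can report a pseudo-saddlepoint of $A$ in $O(n\log n)$ time, querying at most $2n-1$ entries of $A$.
   Context: Entries of $A=(a_{i,j})$ are accessed by queries and compared in constant time. A pseudo-saddlepoint of $A$ is an entry $a_{i,j}=v$ such that every row of $A$ contains an entry $\geq v$ and every column of $A$ contains an entry $\leq v$. *)

(* Defs.v *)
From mathcomp Require Import all_boot all_order all_algebra.

Set Implicit Arguments.
Unset Strict Implicit.
Unset Printing Implicit Defensive.

Definition pseudo_saddlepoint (d : Order.disp_t) (T : orderType d) (n : nat)
    (A : 'M[T]_n) (i j : 'I_n) : Prop :=
  (forall k : 'I_n, exists l : 'I_n, (A i j <= A k l)%O) /\
  (forall l : 'I_n, exists k : 'I_n, (A k l <= A i j)%O).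

(** Running time is measured on a structured word RAM.  The machine has a memory
    of w-bit words and a separate memory for matrix entries.  Entries are opaque:
    they can only be queried, copied and compared with one another.  A program is
    a finite piece of syntax that mentions neither the dimension n, nor the
    ordered set, nor the matrix. *)

Inductive exp : Type :=
| Lit (k : nat)
| Mem (e : exp)            (* content of the word cell with address e *)
| Add (e1 e2 : exp)
| Sub (e1 e2 : exp)        (* truncated at 0 *)
| Mul (e1 e2 : exp)
| Div (e1 e2 : exp).       (* quotient rounded down; 0 if e2 is 0 *)

Inductive test : Type :=
| WordLe (e1 e2 : exp)
| EntryLe (e1 e2 : exp)    (* compares the entry cells with addresses e1, e2 *)
| Not (b : test).

Inductive cmd : Type :=
| Skip
| Store (a e : exp)        (* word cell a := e *)
| Copy (a e : exp)         (* entry cell a := entry cell e *)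
| Query (a r c : exp)      (* entry cell a := A r c *)
| Seq (p1 p2 : cmd)
| If (b : test) (p1 p2 : cmd)
| While (b : test) (p : cmd).

(** Every operation occurring in an expression or a test costs one time unit. *)

Fixpoint exp_cost (e : exp) : nat :=
  match e with
  | Lit _ => 1
  | Mem e1 => (exp_cost e1).+1
  | Add e1 e2 | Sub e1 e2 | Mul e1 e2 | Div e1 e2 =>
      (exp_cost e1 + exp_cost e2).+1
  end.

Fixpoint test_cost (b : test) : nat :=
  match b with
  | WordLe e1 e2 | EntryLe e1 e2 => (exp_cost e1 + exp_cost e2).+1
  | Not b1 => (test_cost b1).+1
  end.

Record state (T : Type) : Type := State {
  words : nat -> nat;
  entries : nat -> option T    (* [None] until the cell is first written *)
}.

Definition lift2 (X Y Z : Type) (f : X -> Y -> option Z)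
    (x : option X) (y : option Y) : option Z :=
  obind (fun u => obind (f u) y) x.

(** A number that does not fit into a w-bit word is undefined, and a program
    that computes one is stuck; so is one that reads an unwritten entry cell or
    queries outside of the matrix. *)

Definition as_word (w v : nat) : option nat :=
  if v < 2 ^ w then Some v else None.

Fixpoint eval (w : nat) (m : nat -> nat) (e : exp) : option nat :=
  match e with
  | Lit k => as_word w k
  | Mem e1 => obind (fun a => as_word w (m a)) (eval w m e1)
  | Add e1 e2 => lift2 (fun u v => as_word w (u + v)) (eval w m e1) (eval w m e2)
  | Sub e1 e2 => lift2 (fun u v => as_word w (u - v)) (eval w m e1) (eval w m e2)
  | Mul e1 e2 => lift2 (fun u v => as_word w (u * v)) (eval w m e1) (eval w m e2)
  | Div e1 e2 => lift2 (fun u v => as_word w (u %/ v)) (eval w m e1) (eval w m e2)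
  end.

Definition entry_at (T : Type) (w : nat) (s : state T) (e : exp) : option T :=
  obind (entries s) (eval w (words s) e).

Fixpoint eval_test (d : Order.disp_t) (T : orderType d) (w : nat) (s : state T)
    (b : test) : option bool :=
  match b with
  | WordLe e1 e2 =>
      lift2 (fun u v => Some (u <= v)) (eval w (words s) e1) (eval w (words s) e2)
  | EntryLe e1 e2 =>
      lift2 (fun x y => Some (x <= y)%O) (entry_at w s e1) (entry_at w s e2)
  | Not b1 => omap negb (eval_test w s b1)
  end.

(** [exec A w p s s' t q]: with word length w, the program p started in s halts in
    s' after t time units, having performed q queries to A (a repeated query to
    the same entry counts again). *)

Inductive exec (d : Order.disp_t) (T : orderType d) (n : nat) (A : 'M[T]_n)
    (w : nat) : cmd -> state T -> state T -> nat -> nat -> Prop :=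
| ExecSkip s : exec A w Skip s s 1 0
| ExecStore s a e k v :
    eval w (words s) a = Some k -> eval w (words s) e = Some v ->
    exec A w (Store a e) s (State [eta words s with k |-> v] (entries s))
      (exp_cost a + exp_cost e).+1 0
| ExecCopy s a e k x :
    eval w (words s) a = Some k -> entry_at w s e = Some x ->
    exec A w (Copy a e) s (State (words s) [eta entries s with k |-> Some x])
      (exp_cost a + exp_cost e).+1 0
| ExecQuery s a r c k (i j : 'I_n) :
    eval w (words s) a = Some k ->
    eval w (words s) r = Some (val i) -> eval w (words s) c = Some (val j) ->
    exec A w (Query a r c) s
      (State (words s) [eta entries s with k |-> Some (A i j)])
      (exp_cost a + exp_cost r + exp_cost c).+1 1
| ExecSeq p1 p2 s s1 s2 t1 t2 q1 q2 :
    exec A w p1 s s1 t1 q1 -> exec A w p2 s1 s2 t2 q2 ->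
    exec A w (Seq p1 p2) s s2 (t1 + t2) (q1 + q2)
| ExecIf b p1 p2 s s1 v t q :
    eval_test w s b = Some v -> exec A w (if v then p1 else p2) s s1 t q ->
    exec A w (If b p1 p2) s s1 (test_cost b + t) q
| ExecWhileDone b p s :
    eval_test w s b = Some false ->
    exec A w (While b p) s s (test_cost b) 0
| ExecWhileStep b p s s1 s2 t1 t2 q1 q2 :
    eval_test w s b = Some true ->
    exec A w p s s1 t1 q1 -> exec A w (While b p) s1 s2 t2 q2 ->
    exec A w (While b p) s s2 (test_cost b + t1 + t2) (q1 + q2).

(** The input is n in word cell 0; all other word cells are 0.  The output is an
    entry: its row and column in word cells 0 and 1, its value in entry cell 0. *)

Definition start (T : Type) (n : nat) : state T :=
  State [eta (fun _ => 0) with 0 |-> n] (fun _ => None).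

Definition reports (d : Order.disp_t) (T : orderType d) (n : nat) (A : 'M[T]_n)
    (s : state T) (i j : 'I_n) : Prop :=
  [/\ words s 0 = i, words s 1 = j & entries s 0 = Some (A i j)].

Definition bit_length (n : nat) : nat := (trunc_log 2 n).+1.

(* Main.v *)
Require Import Defs.
From mathcomp Require Import all_boot all_order all_algebra.
From mathcomp Require Import zify.
(* mathcomp also exports [Mem] and [Sub]. *)
Import Defs.

(** Keep a set of slots, initially the n diagonal entries, each of which matches
    a row with a column.  While the smallest slot [a] and the largest slot [z]
    differ, query the entry [y] in the row of [a] and the column of [z].
    If [y] is at least the maximum, then the row and the column of [a] are
    satisfied by every value in the current range, and [a] is dropped; if [y] is
    at most the minimum, then [z] is dropped; otherwise [y] replaces [a], and the
    row of [z] and the column of [a] are satisfied.  The range only shrinks, so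
    what is satisfied stays so, and when all slots are equal any of them is a
    pseudo-saddlepoint.  This costs n queries for the diagonal and one per
    dropped slot.  The minimum and the maximum are maintained in two tournament
    trees, with O(log n) time per change of a leaf. *)

Set Implicit Arguments.
Unset Strict Implicit.
Unset Printing Implicit Defensive.

(** * Evaluation of expressions without overflow *)

Fixpoint den (m : nat -> nat) (e : exp) : nat :=
  match e with
  | Lit k => k
  | Mem a => m (den m a)
  | Add a b => den m a + den m b
  | Sub a b => den m a - den m b
  | Mul a b => den m a * den m b
  | Div a b => den m a %/ den m b
  end.

(** [Sub] and [Div] carry no bound of their own, since their results never exceed the first operand.
    Splitting the semantics into [den] and [fits] turns every evaluation into an arithmetic side
    condition. *)
Fixpoint fits (B : nat) (m : nat -> nat) (e : exp) : bool :=
  match e with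
  | Lit k => k < B
  | Mem a => fits B m a && (m (den m a) < B)
  | Add a b => [&& fits B m a, fits B m b & den m a + den m b < B]
  | Sub a b => fits B m a && fits B m b
  | Mul a b => [&& fits B m a, fits B m b & den m a * den m b < B]
  | Div a b => fits B m a && fits B m b
  end.

Lemma as_word_lt w v : v < 2 ^ w -> as_word w v = Some v.
Proof. by rewrite /as_word => ->. Qed.

Lemma fits_den B m e : fits B m e -> den m e < B.
Proof.
elim: e => //= [e _ /andP[] //|a _ b _ /and3P[] //|a IHa b _|a _ b _ /and3P[] //|].
  by case/andP=> /IHa h _; apply: leq_ltn_trans h; rewrite leq_subr.
move=> a IHa b _ /andP[/IHa h _]; apply: leq_ltn_trans h; exact: leq_div.
Qed.

Lemma eval_fits B w m e : B <= 2 ^ w -> fits B m e -> eval w m e = Some (den m e).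
Proof.
move=> hB; have lt v : v < B -> as_word w v = Some v.
  by move=> h; apply: as_word_lt; apply: leq_trans hB.
elim: e => /=.
- by move=> k /lt.
- by move=> e IH /andP[/IH -> /lt /= ->].
- by move=> a IHa b IHb /and3P[/IHa -> /IHb -> /lt /= ->].
- move=> a IHa b IHb /andP[ha hb]; rewrite (IHa ha) (IHb hb) /=; apply: lt.
  exact: (@fits_den B m (Sub a b) (introT andP (conj ha hb))).
- by move=> a IHa b IHb /and3P[/IHa -> /IHb -> /lt /= ->].
- move=> a IHa b IHb /andP[ha hb]; rewrite (IHa ha) (IHb hb) /=; apply: lt.
  exact: (@fits_den B m (Div a b) (introT andP (conj ha hb))).
Qed.

(** * Total correctness with time and query counts *)

Definition wp (d : Order.disp_t) (T : orderType d) (n : nat) (A : 'M[T]_n)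
    (w : nat) (p : cmd) (s : state T) (Q : state T -> nat -> nat -> Prop) : Prop :=
  exists s' t q, exec A w p s s' t q /\ Q s' t q.

Section WeakestPrecondition.
Context {d : Order.disp_t} {T : orderType d} {n : nat} {A : 'M[T]_n}.
Context {w : nat}.
Implicit Types (s : state T) (Q : state T -> nat -> nat -> Prop).

Lemma wp_conseq p s Q Q' :
  wp A w p s Q -> (forall s' t q, Q s' t q -> Q' s' t q) -> wp A w p s Q'.
Proof. by move=> [s' [t [q [h hQ]]]] hh; exists s', t, q; split=> //; apply: hh. Qed.

Lemma wp_skip s Q : Q s 1 0 -> wp A w Skip s Q.
Proof. by move=> h; exists s, 1, 0; split=> //; constructor. Qed.

Lemma wp_seq p1 p2 s Q :
  wp A w p1 s (fun s1 t1 q1 => wp A w p2 s1 (fun s2 t2 q2 => Q s2 (t1 + t2) (q1 + q2))) ->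
  wp A w (Seq p1 p2) s Q.
Proof.
move=> [s1 [t1 [q1 [h1 [s2 [t2 [q2 [h2 h]]]]]]]].
by exists s2, (t1 + t2), (q1 + q2); split=> //; econstructor; eauto.
Qed.

Lemma wp_if b p1 p2 v s Q :
  eval_test w s b = Some v ->
  wp A w (if v then p1 else p2) s (fun s' t q => Q s' (test_cost b + t) q) ->
  wp A w (If b p1 p2) s Q.
Proof.
move=> hv [s' [t [q [h hQ]]]]; do 3!eexists; split; last exact: hQ.
by econstructor; eauto.
Qed.

(** The index of [I] is fuel: it drops with every iteration and so bounds their number, while an
    early exit is allowed. At index 0 there is no predecessor, which forces the guard to be false.
    The extra [test_cost b] pays for the last, failing test. *)
Lemma wp_while (I : nat -> state T -> Prop) b p K D :
  (forall k s, I k s ->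
     eval_test w s b = Some false \/
     exists2 k', k = k'.+1 &
       eval_test w s b = Some true /\
       wp A w p s (fun s' t q => [/\ I k' s', t <= K & q <= D])) ->
  forall k s, I k s ->
  wp A w (While b p) s (fun s' t q =>
    [/\ exists k', I k' s', eval_test w s' b = Some false,
        t <= k * (test_cost b + K) + test_cost b & q <= k * D]).
Proof.
move=> step; elim=> [|k IH] s hI.
  case: (step _ _ hI) => [hF|[k' //]].
  by exists s, (test_cost b), 0; split; [constructor | split=> //; exists 0].
case: (step _ _ hI) => [hF|[k' [<-] [hT [s1 [t1 [q1 [e1 [hI1 ht1 hq1]]]]]]]].
  exists s, (test_cost b), 0; split; [by constructor | split=> //].
  - by exists k.+1.
  - by rewrite leq_addl.
have [s2 [t2 [q2 [e2 [hI2 hF ht2 hq2]]]]] := IH _ hI1.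
exists s2, (test_cost b + t1 + t2), (q1 + q2); split; first by econstructor; eauto.
split=> //; rewrite mulSn; lia.
Qed.

Context {B : nat} (hB : B <= 2 ^ w).

Lemma wp_store a e s Q :
  fits B (words s) a && fits B (words s) e ->
  Q (State [eta words s with den (words s) a |-> den (words s) e] (entries s))
    (exp_cost a + exp_cost e).+1 0 ->
  wp A w (Store a e) s Q.
Proof.
by case/andP=> ha he h; do 3!eexists; split; [constructor; exact: (eval_fits hB)|exact: h].
Qed.

Lemma wp_copy a e x s Q :
  fits B (words s) a && fits B (words s) e ->
  entries s (den (words s) e) = Some x ->
  Q (State (words s) [eta entries s with den (words s) a |-> Some x])
    (exp_cost a + exp_cost e).+1 0 ->
  wp A w (Copy a e) s Q.
Proof.
case/andP=> ha he hx h; do 3!eexists; split; last exact: h.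
constructor; first exact: (eval_fits hB).
by rewrite /entry_at (eval_fits hB he).
Qed.

Lemma wp_query a r c (i j : 'I_n) s Q :
  [&& fits B (words s) a, fits B (words s) r & fits B (words s) c] ->
  den (words s) r = i -> den (words s) c = j ->
  Q (State (words s) [eta entries s with den (words s) a |-> Some (A i j)])
    (exp_cost a + exp_cost r + exp_cost c).+1 1 ->
  wp A w (Query a r c) s Q.
Proof.
case/and3P=> ha hr hc hi hj h; do 3!eexists; split; last exact: h.
apply: ExecQuery; first exact: (eval_fits hB).
  by rewrite (eval_fits hB hr) hi.
by rewrite (eval_fits hB hc) hj.
Qed.

Lemma eval_test_word a e s :
  fits B (words s) a && fits B (words s) e ->
  eval_test w s (WordLe a e) = Some (den (words s) a <= den (words s) e).
Proof. by case/andP=> ha he /=; rewrite !(eval_fits hB). Qed.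

Lemma eval_test_entry a e s x y :
  fits B (words s) a && fits B (words s) e ->
  entries s (den (words s) a) = Some x -> entries s (den (words s) e) = Some y ->
  eval_test w s (EntryLe a e) = Some (x <= y)%O.
Proof. by case/andP=> ha he /= hx hy; rewrite /entry_at !(eval_fits hB) //= hx hy. Qed.

End WeakestPrecondition.

(** * Tournament trees for the minimum and the maximum *)

(** Node [v] of the tournament tree [b] is stored in word cell [node b v]; the
    children of [v] are [2v] and [2v + 1], the root is 1, and the leaf of slot
    [i < n] is [n + i].  A node contains [i + 1] if slot [i] wins below it and
    [0] if there is no active slot below it. *)
Definition node (b : bool) (v : nat) : nat := 8 + b + 4 * v.

(** [b] is true in the tree of the maximum and false in that of the minimum. *)
Definition better d (T : orderType d) (b : bool) (E : nat -> option T) (x y : nat) :=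
  if (E x, E y) is (Some u, Some v) then if b then (v <= u)%O else (u <= v)%O
  else false.

Definition winner d (T : orderType d) (b : bool) (E : nat -> option T) (x y : nat) :=
  if x == 0 then y else if y == 0 then x else if better b E x y then x else y.

Section Tree.
Context {d : Order.disp_t} {T : orderType d} {n : nat}.
Implicit Types (m : nat -> nat) (E : nat -> option T) (S : {set 'I_n}).

Definition written E x := E x <> None.

Definition leaves b m S :=
  forall i : 'I_n, m (node b (n + i)) = if i \in S then i.+1 else 0.

(** Internal nodes are 1 to [n - 1] and leaves [n] to [2n - 1], for any [n], without padding to a
    power of two; for [n = 1] the only leaf is the root. *)
Definition tree b m E S :=
  [/\ leaves b m S,
      forall v, 0 < v < n ->
        m (node b v) = winner b E (m (node b v.*2)) (m (node b v.*2.+1))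
    & forall i : 'I_n, i \in S -> written E i.+1].

Lemma node_inj b u v : node b u = node b v -> u = v.
Proof. rewrite /node; lia. Qed.

Lemma tree_val b m E S v : tree b m E S -> 0 < v < n.*2 ->
  m (node b v) = 0 \/ exists2 i : 'I_n, i \in S & m (node b v) = i.+1.
Proof.
(* Children have larger indices than their parent, so the induction runs on the distance to
   [n.*2]. *)
move=> [hl hi hw]; move: {2}(n.*2 - v) (leqnn (n.*2 - v)) => k.
elim: k v => [|k IH] v hk hv; first by lia.
case: (ltnP v n) => hvn.
  have h1 : m (node b v.*2) = 0 \/ exists2 i : 'I_n, i \in S & m (node b v.*2) = i.+1.
    by apply: IH; lia.
  have h2 : m (node b v.*2.+1) = 0 \/
      exists2 i : 'I_n, i \in S & m (node b v.*2.+1) = i.+1.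
    by apply: IH; lia.
  rewrite hi; last lia.
  by rewrite /winner; case: eqP => // _; case: eqP => // _; case: better.
have hj : v - n < n by lia.
move: (hl (Ordinal hj)); rewrite /= subnKC // => ->.
by case: ifP => h; [right; exists (Ordinal hj)|left].
Qed.

Lemma better_trans b E : transitive (better b E).
Proof.
move=> y x z; rewrite /better; case: (E x) (E y) (E z) => [u|] [v|] [z'|] //.
case: b => h1 h2; [exact: Order.POrderTheory.le_trans h2 h1|].
exact: Order.POrderTheory.le_trans h1 h2.
Qed.

Lemma better_total b E x y : written E x -> written E y ->
  better b E x y || better b E y x.
Proof.
rewrite /written /better; case: (E x) (E y) => [u|] [v|] // _ _.
by case: b; rewrite Order.TotalTheory.le_total.
Qed.

Lemma better_refl b E x : written E x -> better b E x x.
Proof.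
rewrite /written /better; case: (E x) => [u|] // _.
by case: b; rewrite Order.POrderTheory.lexx.
Qed.

Lemma winnerP b E x y z : (x = 0 \/ written E x) -> (y = 0 \/ written E y) ->
  z = x \/ z = y -> z <> 0 ->
  winner b E x y <> 0 /\ better b E (winner b E x y) z.
Proof.
rewrite /winner; case: eqP => [->|hx] wx wy hz z0.
  case: wy hz => [->|wy]; first by case.
  by case=> // zy; subst z; split=> //; apply: better_refl.
case: eqP => [y0|hy].
  by case: hz => [zx|]; [|congruence]; subst z; split=> //; apply: better_refl; case: wx.
have {}wx : written E x by case: wx.
have {}wy : written E y by case: wy.
case: ifP => hb; split=> //; case: hz => ->//; try exact: better_refl.
by move: (better_total b wx wy); rewrite hb.
Qed.

(** A nonempty node never beats its parent strictly, so following the path from an active leaf up to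
    node 1 compares the root with every active slot. *)
Lemma tree_root b m E S : tree b m E S -> 0 < #|S| ->
  exists2 i : 'I_n, i \in S & m (node b 1) = i.+1 /\
    forall j : 'I_n, j \in S -> better b E i.+1 j.+1.
Proof.
move=> ht hS; have [hl hi hw] := ht.
have hv v : 0 < v < n.*2 -> m (node b v) = 0 \/ written E (m (node b v)).
  move=> h; case: (tree_val ht h) => [|[i iS ->]]; first by left.
  by right; apply: hw.
have up v : 0 < v < n.*2 -> m (node b v) <> 0 ->
    m (node b 1) <> 0 /\ better b E (m (node b 1)) (m (node b v)).
  elim/ltn_ind: v => v IH hvn v0.
  case: (ltnP 1 v) => h1; last first.
    have v1 : v = 1 by lia.
    subst v; split=> //; apply: better_refl.
    by case: (hv 1 hvn).
  have hh : 0 < v./2 < n by lia.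
  have [u0 hu] : m (node b v./2) <> 0 /\ better b E (m (node b v./2)) (m (node b v)).
    rewrite (hi _ hh); apply: winnerP => //; try by apply: hv; lia.
    (* The parity of [v] tells which child of [v./2] it is. *)
    by rewrite -{1 3}(odd_double_half v); case: (odd v); [right|left].
  have [] // := IH v./2 _ _ u0; try lia.
  by move=> r0 hr; split=> //; exact: better_trans hr hu.
case/card_gt0P: hS => i0 i0S.
have leaf (j : 'I_n) : j \in S -> m (node b 1) <> 0 /\ better b E (m (node b 1)) j.+1.
  move=> jS; have := up (n + j); rewrite (hl j) jS; apply=> //.
  by have := ltn_ord j; lia.
have [r0 _] := leaf _ i0S.
have h1 : 0 < 1 < n.*2 by have := ltn_ord i0; lia.
have [//|[i iS hr]] := tree_val ht h1; exists i => //; split=> // j jS; rewrite -hr.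
by have [] := leaf _ jS.
Qed.

(** Only entries of active slots are ever compared, so the entry cell of an inactive slot may be
    overwritten freely. *)
Lemma tree_entries b m E E' S : tree b m E S ->
  (forall i : 'I_n, i \in S -> E' i.+1 = E i.+1) -> tree b m E' S.
Proof.
move=> ht hE; have [hl hi hw] := ht; split=> // [v hv|i iS]; last first.
  by rewrite /written hE //; apply: hw.
rewrite hi // /winner /better.
have h2 : 0 < v.*2 < n.*2 by lia.
have h3 : 0 < v.*2.+1 < n.*2 by lia.
have [e2|[i iS e2]] := tree_val ht h2; rewrite e2 //=.
have [e3|[j jS e3]] := tree_val ht h3; rewrite e3 //=.
by rewrite (hE i iS) (hE j jS).
Qed.

Lemma tree_words b m m' E S : tree b m E S ->
  (forall v, 0 < v -> m' (node b v) = m (node b v)) -> tree b m' E S.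
Proof.
move=> [hl hi hw] hm; split=> // [i|v hv].
  by rewrite hm ?hl //; have := ltn_ord i; lia.
have h2 : 0 < v.*2 by lia.
have h3 : 0 < v by lia.
by rewrite (hm v h3) (hm v.*2 h2) (hm v.*2.+1 isT) hi.
Qed.

End Tree.

(** * Restoring the trees after the change of a leaf *)

Definition cell (k : nat) : exp := Mem (Lit k).
Definition addr (k : nat) (e : exp) : exp := Add (Lit k) (Mul (Lit 4) e).

(** Word cells: 0 contains n, 2 the slot whose leaf changes, 3 the new content of
    that leaf, 4 the current node on the way to the root, 5 and 6 the minimal and
    the maximal slot, [10 + 4 * i] the column of slot [i]; its row is [i].  Entry
    cell [i + 1] contains the value of slot [i], entry cell 0 the last query. *)
Definition replay (b : bool) : cmd :=
  let l := Mem (addr (8 + b) (Mul (Lit 2) (cell 4))) in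
  let r := Mem (addr (8 + b) (Add (Mul (Lit 2) (cell 4)) (Lit 1))) in
  let dst := addr (8 + b) (cell 4) in
  If (WordLe l (Lit 0)) (Store dst r)
    (If (WordLe r (Lit 0)) (Store dst l)
      (If (if b then EntryLe r l else EntryLe l r) (Store dst l) (Store dst r))).

Definition climb (b : bool) : cmd :=
  While (WordLe (Lit 1) (cell 4))
    (Seq (replay b) (Store (Lit 4) (Div (cell 4) (Lit 2)))).

(** The climb starts at the parent of the leaf and stops after the root, when halving yields 0. For
    [n = 1] the parent is already 0 and the loop does nothing. *)
Definition update (b : bool) : cmd :=
  Seq (Store (addr (8 + b) (Add (cell 0) (cell 2))) (cell 3))
    (Seq (Store (Lit 4) (Div (Add (cell 0) (cell 2)) (Lit 2))) (climb b)).

Definition update_both : cmd := Seq (update false) (update true).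

Section Updates.
Context {d : Order.disp_t} {T : orderType d} {n : nat} {A : 'M[T]_n}.
Context {w : nat} (hB : 100 * n <= 2 ^ w).
Implicit Types (s : state T) (S : {set 'I_n}).

Definition valid (E : nat -> option T) x :=
  x = 0 \/ exists2 i : 'I_n, x = i.+1 & written E i.+1.

Lemma wp_replay b s P x y (Q : state T -> nat -> nat -> Prop) :
  words s 4 = P -> 0 < P < n ->
  words s (node b P.*2) = x -> words s (node b P.*2.+1) = y ->
  valid (entries s) x -> valid (entries s) y ->
  (forall t, t <= 80 ->
     Q (State [eta words s with node b P |-> winner b (entries s) x y] (entries s)) t 0) ->
  wp A w (replay b) s Q.
Proof.
move=> hP Pn hx hy vx vy hQ.
have xn : x <= n by case: vx => [->|[i -> _]].
have yn : y <= n by case: vy => [->|[i -> _]].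
have e2 : 8 + b + 4 * (2 * P) = node b P.*2 by rewrite /node; lia.
have e3 : 8 + b + 4 * (2 * P + 1) = node b P.*2.+1 by rewrite /node; lia.
have e1 : 8 + b + 4 * P = node b P by [].
have [l1 l2] : node b P < 100 * n /\ node b P.*2.+1 < 100 * n.
  by rewrite /node; split; lia.
have l3 : node b P.*2 < 100 * n by rewrite /node; lia.
apply: wp_if.
  apply: (eval_test_word hB).
  by rewrite /= hP e2 hx; lia.
rewrite /= hP e2 hx.
have -> : (x <= 0) = (x == 0) by lia.
case: ifP => x0.
  apply: (wp_store hB); rewrite /= hP e3 hy e1; first by lia.
  have -> : y = winner b (entries s) x y by rewrite /winner x0.
  by apply: hQ.
apply: wp_if.
  apply: (eval_test_word hB).
  by rewrite /= hP e3 hy; lia.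
rewrite /= hP e3 hy.
have -> : (y <= 0) = (y == 0) by lia.
case: ifP => y0.
  apply: (wp_store hB); rewrite /= hP e2 hx e1; first by lia.
  have -> : x = winner b (entries s) x y by rewrite /winner x0 y0.
  by apply: hQ.
have [u hu] : exists u, entries s x = Some u.
  case: vx => [ex|[i -> hw]]; first by rewrite ex in x0.
  by move: hw; rewrite /written; case: (entries s _) => // u _; exists u.
have [v hv] : exists v, entries s y = Some v.
  case: vy => [ey|[i -> hw]]; first by rewrite ey in y0.
  by move: hw; rewrite /written; case: (entries s _) => // v _; exists v.
apply: (wp_if (v := better b (entries s) x y)).
  rewrite /better hu hv.
  by case: b {hQ} hx hy e2 e3 e1 l1 l2 l3 => hx hy e2 e3 e1 l1 l2 l3;
    apply: (eval_test_entry hB); rewrite /= ?hP ?e2 ?e3 ?hx ?hy //; lia.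
case: ifP => hb.
  apply: (wp_store hB); rewrite /= hP e2 hx e1; first by lia.
  have -> : x = winner b (entries s) x y by rewrite /winner x0 y0 hb.
  by apply: hQ; case: (b).
apply: (wp_store hB); rewrite /= hP e3 hy e1; first by lia.
have -> : y = winner b (entries s) x y by rewrite /winner x0 y0 hb.
by apply: hQ; case: (b).
Qed.

Definition ancestor (u v : nat) := exists k, u = iter k half v.

Definition same_but (b : bool) (m m' : nat -> nat) :=
  forall a, a <> 4 -> (forall v, 0 < v -> a <> node b v) -> m' a = m a.

(** Only the path from the current node to the root, including the current node, may be stale
    ([ancestor] is reflexive). Validity guarantees that the entries compared by [replay] are
    written. The bound [2 ^ k] makes [k] the fuel, since each halving lowers it by one. *)
Definition climb_inv b s0 S k s :=
  [/\ entries s = entries s0, same_but b (words s0) (words s),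
      leaves b (words s) S,
      (forall v, 0 < v < n.*2 -> valid (entries s0) (words s (node b v))) &
      (forall v, 0 < v < n -> ~ ancestor v (words s 4) ->
        words s (node b v) = winner b (entries s0)
          (words s (node b v.*2)) (words s (node b v.*2.+1)))
      /\ words s 4 < n /\ words s 4 < 2 ^ k].

Lemma climb_step b s0 S k s : climb_inv b s0 S k s ->
  eval_test w s (WordLe (Lit 1) (cell 4)) = Some false \/
  exists2 k', k = k'.+1 &
    eval_test w s (WordLe (Lit 1) (cell 4)) = Some true /\
    wp A w (Seq (replay b) (Store (Lit 4) (Div (cell 4) (Lit 2)))) s
      (fun s' t q => [/\ climb_inv b s0 S k' s', t <= 90 & q <= 0]).
Proof.
move=> [hE hsame hl hval [heq [Pn Pk]]].
set P := words s 4 in heq Pn Pk *.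
have -> : eval_test w s (WordLe (Lit 1) (cell 4)) = Some (0 < P).
  by apply: (eval_test_word hB); rewrite /= -/P; lia.
case: (posnP P) => [P0|P0]; first by left.
case: k Pk => [|k] Pk; first by rewrite expn0 in Pk; lia.
right; exists k => //; split=> //.
apply: wp_seq; apply: (wp_replay (P := P)); rewrite ?hE //; first by lia.
- by apply: hval; lia.
- by apply: hval; lia.
move=> t ht; apply: (wp_store hB) => /=.
  by rewrite -/P; lia.
rewrite -/P divn2; set m := (X in State X _).
have mE v : v <> P -> m (node b v) = words s (node b v).
  move=> vP; rewrite /m /=.
  by case: eqP => // /node_inj.
have mP : m (node b P) = winner b (entries s0) (words s (node b P.*2))
    (words s (node b P.*2.+1)).
  by rewrite /m /= eqxx.
have m4 : m 4 = P./2 by [].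
split; [split=> //=|lia|by []].
- move=> a a4 ha; rewrite /m /=.
  have -> : (a == 4) = false by lia.
  have -> : (a == node b P) = false by apply/eqP; apply: ha.
  exact: hsame.
- by move=> i; rewrite mE ?hl //; lia.
- move=> v hv; case: (v =P P) => [->|/mE -> //]; last exact: hval.
  have h2 : valid (entries s0) (words s (node b P.*2)) by apply: hval; lia.
  have h3 : valid (entries s0) (words s (node b P.*2.+1)) by apply: hval; lia.
  by rewrite mP /winner; case: ifP => // _; case: ifP => // _; case: ifP.
rewrite m4; split; last by rewrite expnS in Pk; lia.
(* If [P] were a child of [v], then [v] would be [P./2], an ancestor of the new current node; so
   both children of [v] are unchanged. *)
move=> v hv hanc; have nchild c : c./2 = v -> c <> P.
  by move=> cv cP; apply: hanc; exists 0; rewrite /= -cP cv.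
rewrite (mE v.*2); last by apply: nchild; lia.
rewrite (mE v.*2.+1); last by apply: nchild; lia.
case: (v =P P) => [->|vP]; first by rewrite mP.
(* A proper ancestor of [P] is an ancestor of [P./2], so the equation at [v] already held before
   this step. *)
rewrite mE // heq // => -[[|j] hj]; first exact: vP.
by apply: hanc; exists j; rewrite hj iterSr.
Qed.

Lemma wp_update b s S S' (i : 'I_n) x :
  tree b (words s) (entries s) S ->
  words s 0 = n -> words s 2 = i -> words s 3 = x ->
  valid (entries s) x ->
  S' = (if x == 0 then S :\ i else i |: S) -> (x <> 0 -> x = i.+1) ->
  wp A w (update b) s (fun s' t q =>
    [/\ tree b (words s') (entries s') S', entries s' = entries s,
        same_but b (words s) (words s'),
        t <= 200 * (trunc_log 2 n).+1 & q = 0]).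
Proof.
move=> ht h0 h2 h3 hx hS' xi; have [hl hi hw] := ht.
have xn : x <= n by case: hx => [->|[j -> _]].
have iN := ltn_ord i.
have e1 : 8 + b + 4 * (n + i) = node b (n + i) by [].
have l1 : node b (n + i) < 100 * n by rewrite /node; lia.
apply: wp_seq; apply: (wp_store hB); rewrite /= h0 h2 h3 e1; first by lia.
apply: wp_seq; apply: (wp_store hB); rewrite /= h0 h2; first by lia.
rewrite divn2; set m := (X in State X _).
have mE v : v <> n + i -> m (node b v) = words s (node b v).
  move=> vP; rewrite /m /=.
  by case: eqP => // /node_inj.
have mP : m (node b (n + i)) = x.
  by rewrite /m /= eqxx.
(* The parent of the leaf is below [n], hence below [2 ^ (trunc_log 2 n).+1]; this is the
   logarithmic fuel. *)
have hinv : climb_inv b s S' (trunc_log 2 n).+1 (State m (entries s)).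
  split=> //=.
  - move=> a a4 ha; rewrite /m /=.
    have -> : (a == 4) = false by lia.
    by have -> : (a == node b (n + i)) = false by apply/eqP; apply: ha; lia.
  - move=> j; case: (j =P i) => [->|ji].
      by rewrite mP hS'; case: eqP => [->|/xi ->]; rewrite !inE eqxx.
    rewrite mE; last by move=> h; apply: ji; apply: val_inj => /=; lia.
    by rewrite hl hS'; case: (x == 0); rewrite !inE; move/eqP/negbTE: ji => ->.
  - move=> v hv; case: (v =P n + i) => [->|/mE ->]; first by rewrite mP.
    case: (tree_val ht hv) => [->|[j jS ->]]; first by left.
    by right; exists j => //; apply: hw.
  - have m4 : m 4 = (n + i)./2 by [].
    rewrite m4; split; last by split; [lia|]; have := trunc_log_ltn n (isT : 1 < 2); lia.
    move=> v hv hanc; have nchild c : c./2 = v -> c <> n + i.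
      by move=> cv cP; apply: hanc; exists 0; rewrite /= -cP cv.
    rewrite (mE v.*2); last by apply: nchild; lia.
    rewrite (mE v.*2.+1); last by apply: nchild; lia.
    have vi : v <> n + i by lia.
    by rewrite (mE v vi) (hi v hv).
apply: wp_conseq (wp_while (@climb_step b s S') hinv) _ => s' t q.
move=> [[k [hE hsame hl' hval [heq [Pn _]]]] hF ht' hq].
have P0 : words s' 4 = 0.
  move: hF; rewrite (eval_test_word hB) /=; last by lia.
  by case; lia.
split.
- split=> // [v hv|j].
    (* The climb ended at 0, whose only ancestor is 0, so no internal node is stale. *)
    rewrite hE; apply: heq => // -[j]; rewrite P0.
    by elim: j => [|j IH]; [move=> /= v0; lia|rewrite iterSr].
  rewrite hE hS'; case: eqP => [_|/xi xE]; rewrite !inE.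
    by case/andP=> _; apply: hw.
  case/orP=> [/eqP ->|]; last exact: hw.
  by case: hx => [|[l]]; rewrite xE // => -[->].
- by [].
- move=> a a4 ha; rewrite hsame //.
- by move: ht' => /=; lia.
- by lia.
Qed.

(** Modulo 4 the two trees occupy the residues 0 and 1 and the columns of the slots the residue 2,
    so updating one tree leaves the other and the columns intact. *)
Lemma wp_update_both s S S' (i : 'I_n) x :
  (forall b, tree b (words s) (entries s) S) ->
  words s 0 = n -> words s 2 = i -> words s 3 = x ->
  valid (entries s) x ->
  S' = (if x == 0 then S :\ i else i |: S) -> (x <> 0 -> x = i.+1) ->
  wp A w update_both s (fun s' t q =>
    [/\ forall b, tree b (words s') (entries s') S', entries s' = entries s,
        forall a, a < 8 -> a <> 4 -> words s' a = words s a,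
        forall j, words s' (10 + 4 * j) = words s (10 + 4 * j) &
        t <= 400 * (trunc_log 2 n).+1 /\ q = 0]).
Proof.
move=> ht h0 h2 h3 hx hS' xi.
apply: wp_seq.
apply: wp_conseq (wp_update (ht false) h0 h2 h3 hx hS' xi) _ => s1 t1 q1.
move=> [ht1 hE1 hs1 hc1 hq1].
have low1 a : a < 8 -> a <> 4 -> words s1 a = words s a.
  by move=> a8 a4; apply: hs1 => // v v0; rewrite /node; lia.
have hx1 : valid (entries s1) x by rewrite hE1.
have ht1' : tree true (words s1) (entries s1) S.
  rewrite hE1; apply: (tree_words (ht true)) => v v0.
  by apply: hs1 => [|u u0]; rewrite /node; lia.
have := wp_update ht1' _ _ _ hx1 hS' xi; rewrite !low1 // => /(_ h0 h2 h3) h.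
apply: wp_conseq h _ => s2 t2 q2 [ht2 hE2 hs2 hc2 hq2].
split.
- case=> //; rewrite hE2; apply: (tree_words ht1) => v v0.
  by apply: hs2 => [|u u0]; rewrite /node; lia.
- by rewrite hE2.
- move=> a a8 a4; rewrite hs2 ?low1 // => v v0; rewrite /node; lia.
- move=> j; have c b v : 10 + 4 * j <> node b v by rewrite /node; lia.
  by rewrite hs2 ?hs1 //; lia.
- by split; lia.
Qed.

End Updates.

(** * Soundness of dropping and exchanging slots *)

Section Soundness.
Context {d : Order.disp_t} {T : orderType d} {n : nat} {A : 'M[T]_n}.
Implicit Types (S : {set 'I_n}) (c : 'I_n -> 'I_n).

(** The rows and columns that are no longer matched by the slots in [S] are
    satisfied by every value within the range of the entries of [S]. *)
Definition sound S c :=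
  (forall i, i \in S \/ exists l, forall x, x \in S -> (A x (c x) <= A i l)%O) /\
  (forall j, (exists2 x, x \in S & c x = j) \/
             exists k, forall x, x \in S -> (A k j <= A x (c x))%O).

Lemma sound_diagonal : sound setT id.
Proof. by split=> i; left; rewrite ?inE //; exists i; rewrite ?inE. Qed.

(** Minimality of [x] settles the rows still matched, through their own slots, and maximality the
    columns still matched; [sound] settles the others. *)
Lemma sound_pseudo_saddlepoint S c x : sound S c -> x \in S ->
  (forall y, y \in S -> (A x (c x) <= A y (c y))%O) ->
  (forall y, y \in S -> (A y (c y) <= A x (c x))%O) ->
  pseudo_saddlepoint A x (c x).
Proof.
move=> [hr hc] xS hmin hmax; split=> k.
  by case: (hr k) => [/hmin|[l /(_ _ xS)]]; [exists (c k)|exists l].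
by case: (hc k) => [[y /hmax h <-]|[l /(_ _ xS)]]; [exists y|exists l].
Qed.

Section Step.
Context {S : {set 'I_n}} {c : 'I_n -> 'I_n} {a z : 'I_n}.
Hypotheses (hS : sound S c) (aS : a \in S) (zS : z \in S).
Hypothesis amin : forall x, x \in S -> (A a (c a) <= A x (c x))%O.
Hypothesis zmax : forall x, x \in S -> (A x (c x) <= A z (c z))%O.

(** Only row [a] and column [c a] lose their slot. The row has the queried entry above the maximum,
    and the column keeps the old minimum itself. *)
Lemma sound_remove_min : (A z (c z) <= A a (c z))%O -> sound (S :\ a) c.
Proof.
move=> hy; case: hS => hr hc; split=> i.
  case: (hr i) => [iS|[l hl]]; last by right; exists l => x /setD1P[_ /hl].
  case: (i =P a) => [->|/eqP ia]; last by left; rewrite !inE ia.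
  right; exists (c z) => x /setD1P[_ /zmax h].
  exact: Order.POrderTheory.le_trans h hy.
case: (hc i) => [[x xS <-]|[k hk]]; last by right; exists k => x /setD1P[_ /hk].
case: (x =P a) => [->|/eqP xa]; last by left; exists x; rewrite // !inE xa.
by right; exists a => y /setD1P[_ /amin].
Qed.

(** Dually, row [z] keeps the old maximum, and column [c z] has the queried entry below the
    minimum. *)
Lemma sound_remove_max : (A a (c z) <= A a (c a))%O -> sound (S :\ z) c.
Proof.
move=> hy; case: hS => hr hc; split=> i.
  case: (hr i) => [iS|[l hl]]; last by right; exists l => x /setD1P[_ /hl].
  case: (i =P z) => [->|/eqP iz]; last by left; rewrite !inE iz.
  by right; exists (c z) => x /setD1P[_ /zmax].
case: (hc i) => [[x xS <-]|[k hk]]; last by right; exists k => x /setD1P[_ /hk].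
case: (x =P z) => [->|/eqP xz]; last by left; exists x; rewrite // !inE xz.
right; exists a => y /setD1P[_ /amin h].
exact: Order.POrderTheory.le_trans hy h.
Qed.

(** Slot [a] takes over column [c z], so only row [z] and column [c a] become unmatched; they
    contain the old maximum and the old minimum. *)
Lemma sound_exchange : a != z ->
  (A a (c a) <= A a (c z))%O -> (A a (c z) <= A z (c z))%O ->
  sound (S :\ z) [eta c with a |-> c z].
Proof.
move=> az h1 h2; case: hS => hr hc.
(* [lo] and [hi] say that the range of slot values only shrinks, so all earlier bounds survive. *)
have lo x : x \in S :\ z ->
    exists2 y, y \in S & (A y (c y) <= A x ([eta c with a |-> c z] x))%O.
  case/setD1P=> xz xS; rewrite /=; case: eqP => [->|_]; first by exists a.
  by exists x => //; exact: Order.POrderTheory.lexx.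
have hi x : x \in S :\ z ->
    exists2 y, y \in S & (A x ([eta c with a |-> c z] x) <= A y (c y))%O.
  case/setD1P=> xz xS; rewrite /=; case: eqP => [->|_]; first by exists z.
  by exists x => //; exact: Order.POrderTheory.lexx.
split=> i.
  case: (i =P z) => [->|/eqP iz].
    right; exists (c z) => x /hi [y yS h].
    exact: Order.POrderTheory.le_trans h (zmax yS).
  case: (hr i) => [iS|[l hl]]; first by left; rewrite !inE iz.
  right; exists l => x /hi [y /hl h h']; exact: Order.POrderTheory.le_trans h' h.
case: (hc i) => [[x xS <-]|[k hk]]; last first.
  right; exists k => x /lo [y /hk h h']; exact: Order.POrderTheory.le_trans h h'.
case: (x =P z) => [->|/eqP xz].
  by left; exists a; rewrite /= ?eqxx // !inE az.
case: (x =P a) => [->|/eqP xa].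
  right; exists a => y /lo [u /amin h h'].
  exact: Order.POrderTheory.le_trans h h'.
by left; exists x; rewrite /= ?(negbTE xa) // !inE xz.
Qed.

End Step.
End Soundness.

(** * The program *)

Definition remove (k : nat) : cmd :=
  Seq (Store (Lit 3) (Lit 0)) (Seq (Store (Lit 2) (cell k)) update_both).

Definition insert : cmd :=
  Seq (Store (Lit 3) (Add (cell 2) (Lit 1))) update_both.

Definition fill : cmd :=
  While (Not (WordLe (cell 0) (cell 2)))
    (Seq (Query (Add (cell 2) (Lit 1)) (cell 2) (cell 2))
    (Seq (Store (addr 10 (cell 2)) (cell 2))
    (Seq insert
         (Store (Lit 2) (Add (cell 2) (Lit 1)))))).

(** Both extreme slots have been removed, and [remove 6] left the maximal one in cell 2. This
    fragment leaves in cell 2 the slot to reinsert: the maximal one if the query reaches the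
    maximum, else the minimal one, whose entry and column are replaced unless the query is at most
    the minimum. *)
Definition select : cmd :=
  If (EntryLe (Add (cell 6) (Lit 1)) (Lit 0)) Skip
    (Seq (Store (Lit 2) (cell 5))
    (If (EntryLe (Lit 0) (Add (cell 5) (Lit 1))) Skip
      (Seq (Copy (Add (cell 5) (Lit 1)) (Lit 0))
           (Store (addr 10 (cell 5)) (Mem (addr 10 (cell 6))))))).

(** Cells 12 and 13 are the roots of the two trees. *)
Definition round : cmd :=
  Seq (Store (Lit 5) (Sub (cell 12) (Lit 1)))
  (Seq (Store (Lit 6) (Sub (cell 13) (Lit 1)))
  (Seq (Query (Lit 0) (cell 5) (Mem (addr 10 (cell 6))))
  (Seq (remove 5) (Seq (remove 6) (Seq select insert))))).

(** Tests offer no equality; the two truncated differences add up to 0 exactly when the roots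
    coincide. *)
Definition shrink : cmd :=
  While (Not (WordLe (Add (Sub (cell 12) (cell 13)) (Sub (cell 13) (cell 12))) (Lit 0)))
    round.

(** Cell 12 contains the slot plus one, which is also the address of its entry. *)
Definition output : cmd :=
  Seq (Copy (Lit 0) (cell 12))
  (Seq (Store (Lit 5) (Sub (cell 12) (Lit 1)))
  (Seq (Store (Lit 1) (Mem (addr 10 (cell 5))))
       (Store (Lit 0) (cell 5)))).

Definition saddle : cmd := Seq fill (Seq shrink output).

(** * Verification of the program *)

Section Main.
Context {d : Order.disp_t} {T : orderType d} {n : nat} {A : 'M[T]_n}.
Context {w : nat} (hB : 100 * n <= 2 ^ w).
Implicit Types (s : state T) (S : {set 'I_n}) (c : 'I_n -> 'I_n).

Notation L := (trunc_log 2 n).+1.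

Definition holds s (c : 'I_n -> 'I_n) (i : 'I_n) :=
  words s (10 + 4 * i) = c i /\ entries s i.+1 = Some (A i (c i)).

Definition rep s S c :=
  [/\ words s 0 = n, forall b, tree b (words s) (entries s) S
    & forall i, i \in S -> holds s c i].

Lemma wp_remove k s S (x : 'I_n) : (k == 5) || (k == 6) ->
  words s 0 = n -> (forall b, tree b (words s) (entries s) S) -> words s k = x ->
  wp A w (remove k) s (fun s' t q =>
    [/\ forall b, tree b (words s') (entries s') (S :\ x), entries s' = entries s,
        forall a, a < 8 -> a \notin [:: 2; 3; 4] -> words s' a = words s a,
        forall j, words s' (10 + 4 * j) = words s (10 + 4 * j) &
        [/\ words s' 2 = x, t <= 420 * L & q = 0]]).
Proof.
move=> hk h0 ht hx; have xn := ltn_ord x.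
have kB : k < 100 * n by case/orP: hk => /eqP ->; lia.
apply: wp_seq; apply: (wp_store hB); first by rewrite /=; lia.
apply: wp_seq; apply: (wp_store hB).
  by case/orP: hk hx kB => /eqP -> /= -> kB; lia.
set s1 := State _ _.
have s12 : words s1 2 = x by case/orP: hk hx @s1 {kB} => /eqP -> /= ->.
have h1 : forall b, tree b (words s1) (entries s1) S.
  by move=> b; apply: tree_words (ht b) _ => v v0; rewrite /s1 /=.
have hv : valid (n := n) (entries s1) 0 by left.
have h2 : S :\ x = if 0 == 0 then S :\ x else x |: S by [].
have h3 : 0 <> 0 -> 0 = x.+1 by [].
apply: wp_conseq
  (wp_update_both hB h1 h0 s12 (erefl : words s1 3 = 0) hv h2 h3) _ => s2 t2 q2.
move=> [ht2 he2 hw2 hc2 [htt hqq]].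
split=> //.
- move=> a a8; rewrite !inE !negb_or => /and3P[/negbTE a2 /negbTE a3 a4].
  by rewrite hw2 //= ?a2 ?a3 //; apply/eqP.
have e2 : words s2 2 = x by rewrite -s12; apply: hw2.
split=> //=; lia.
Qed.

Lemma wp_insert s S c (x : 'I_n) :
  words s 0 = n -> (forall b, tree b (words s) (entries s) S) -> words s 2 = x ->
  (forall i, i \in x |: S -> holds s c i) ->
  wp A w insert s (fun s' t q =>
    [/\ rep s' (x |: S) c, words s' 2 = x, t <= 410 * L & q = 0]).
Proof.
move=> h0 ht hx hh; have xn := ltn_ord x.
apply: wp_seq; apply: (wp_store hB); first by rewrite /= hx; lia.
rewrite /= hx; set s1 := State _ _.
have s13 : words s1 3 = x.+1 by rewrite /s1 /= addn1.
have h1 : forall b, tree b (words s1) (entries s1) S.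
  by move=> b; apply: tree_words (ht b) _ => v v0; rewrite /s1 /=.
have hv : valid (n := n) (entries s1) x.+1.
  by right; exists x => //; have [_] := hh x (setU11 _ _); rewrite /written => ->.
have h2 : x |: S = if x.+1 == 0 then S :\ x else x |: S by [].
apply: wp_conseq (wp_update_both hB h1 h0 hx s13 hv h2 (fun=> erefl)) _ => s2 t2 q2.
move=> [ht2 he2 hw2 hc2 [htt hqq]].
split=> //; try lia; last by rewrite hw2.
split=> // [|i /hh]; first by rewrite hw2.
by rewrite /holds hc2 he2.
Qed.

(** The blank memory already encodes two empty trees, as two absent contestants yield 0. *)
Lemma rep_start : rep (start T n) set0 id.
Proof.
split=> // [b|i]; last by rewrite inE.
by split=> [i|v hv|i]; rewrite ?inE //= /winner.
Qed.

Lemma wp_fill : 0 < n -> wp A w fill (start T n) (fun s t q =>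
  [/\ rep s setT id, t <= n * (500 * L) + 6 & q <= n]).
Proof.
(* [k] diagonal entries remain to be queried; the slots below [i] are active. *)
move=> npos; pose I k s := exists i, [/\ i + k = n, words s 2 = i &
  rep s [set j : 'I_n | j < i] id].
have h0 : I n (start T n).
  exists 0; split=> //.
  have -> : [set j : 'I_n | j < 0] = set0 by apply/setP => j; rewrite !inE.
  exact: rep_start.
have step k s : I k s ->
  eval_test w s (Not (WordLe (cell 0) (cell 2))) = Some false \/
  exists2 k', k = k'.+1 &
    eval_test w s (Not (WordLe (cell 0) (cell 2))) = Some true /\
    wp A w (Seq (Query (Add (cell 2) (Lit 1)) (cell 2) (cell 2))
           (Seq (Store (addr 10 (cell 2)) (cell 2))
           (Seq insert (Store (Lit 2) (Add (cell 2) (Lit 1)))))) s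
      (fun s' t q => [/\ I k' s', t <= 490 * L & q <= 1]).
  move=> [i [ik hi [hn ht hh]]].
  have -> : eval_test w s (Not (WordLe (cell 0) (cell 2))) = Some (i < n).
    rewrite /eval_test -/(eval_test w s (WordLe (cell 0) (cell 2))).
    rewrite (eval_test_word hB) /= hn hi; last by lia.
    by rewrite ltnNge.
  case: k ik => [|k] ik; first by left; congr Some; lia.
  have iN : i < n by lia.
  right; exists k => //; split; first by rewrite iN.
  pose x := Ordinal iN.
  apply: wp_seq; apply: (wp_query (i := x) (j := x) hB) => //.
    by rewrite /= hi; lia.
  apply: wp_seq; apply: (wp_store hB); first by rewrite /= hi; lia.
  rewrite /= hi; set s1 := State _ _.
  have E1 a : a < 8 -> words s1 a = words s a.
    by move=> a8; rewrite /s1 /=; case: eqP => //; lia.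
  have h1 b : tree b (words s1) (entries s1) [set j : 'I_n | j < i].
    apply: (tree_entries (E := entries s)).
      apply: tree_words (ht b) _ => v v0; rewrite /s1 /= /node.
      by case: eqP => //; lia.
    move=> j; rewrite inE => ji; rewrite /s1 /=.
    by case: eqP => //; lia.
  have hU : x |: [set j : 'I_n | j < i] = [set j : 'I_n | j < i.+1].
    by apply/setP => j; rewrite !inE -val_eqE /=; lia.
  have h2 : forall j, j \in x |: [set j : 'I_n | j < i] -> holds s1 id j.
    move=> j; rewrite /holds /s1 /= !inE => /orP[/eqP ->|ji] /=.
      by rewrite addn1 !eqxx.
    have -> : (10 + 4 * j == 10 + 4 * i) = false by lia.
    have -> : (j.+1 == i + 1) = false by lia.
    by apply: hh; rewrite inE.
  apply: wp_seq.
  have := @wp_insert s1 _ id x _ h1 _ h2; rewrite !E1 // => /(_ hn hi) h.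
  apply: wp_conseq h _ => s2 t2 q2 [[hn2 ht2 hh2] hi2 htt hqq].
  apply: (wp_store hB); first by rewrite /= hi2 /=; lia.
  split; last by rewrite hqq.
    exists i.+1; split; [lia|by rewrite /= hi2 addn1|].
    by rewrite -hU; split.
  by rewrite /=; lia.
apply: wp_conseq (wp_while step h0) _ => s t q.
move=> [[k [i [ik hi hrep]]] hF htt hqq].
have hn : i = n.
  move: hF; rewrite /eval_test -/(eval_test w s (WordLe (cell 0) (cell 2))).
  have [h00 _ _] := hrep.
  by rewrite (eval_test_word hB) /= h00 hi; [case; lia|lia].
split; last by lia.
  by move: hrep; rewrite hn; congr rep; apply/setP => j; rewrite !inE ltn_ord.
by move: htt => /=; lia.
Qed.

Lemma wp_round s S c (a z : 'I_n) :
  rep s S c -> sound S c (A := A) -> a \in S -> z \in S -> a != z ->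
  words s 12 = a.+1 -> words s 13 = z.+1 ->
  (forall x, x \in S -> (A a (c a) <= A x (c x))%O) ->
  (forall x, x \in S -> (A x (c x) <= A z (c z))%O) ->
  wp A w round s (fun s' t q =>
    [/\ exists S' c', [/\ rep s' S' c', sound S' c' (A := A) & #|S| = #|S'|.+1],
        t <= 1400 * L & q = 1]).
Proof.
move=> [h0 ht hh] hs aS zS az h12 h13 amin zmax.
have [an zn cn] : [/\ a < n, z < n & c z < n] by split.
have [ca ea] := hh _ aS; have [cz ez] := hh _ zS.
apply: wp_seq; apply: (wp_store hB); first by rewrite /= h12; lia.
rewrite /= h12; apply: wp_seq; apply: (wp_store hB); first by rewrite /= h13; lia.
rewrite /= h13 !subn1 /=; apply: wp_seq; apply: (wp_query (i := a) (j := c z) hB) => //.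
  by rewrite /= cz; lia.
rewrite /=; set s1 := State _ _.
have E1 x : x <> 5 -> x <> 6 -> words s1 x = words s x.
  by move=> x5 x6; rewrite /s1 /=; do 2?[case: eqP => //].
have ht1 b : tree b (words s1) (entries s1) S.
  by apply: (tree_entries (E := entries s)) => //; apply: tree_words (ht b) _.
apply: wp_seq.
apply: wp_conseq (@wp_remove 5 s1 S a isT h0 ht1 erefl) _ => s2 t2 q2.
move=> [ht2 he2 hw2 hc2 [hx2 htt2 hq2]].
have hw2' : words s2 0 = n by rewrite hw2.
have h26 : words s2 6 = z by rewrite hw2.
apply: wp_seq.
apply: wp_conseq (@wp_remove 6 s2 _ z isT hw2' ht2 h26) _ => s3 t3 q3.
move=> [ht3 he3 hw3 hc3 [hx3 htt3 hq3]].
have h30 : words s3 0 = n by rewrite hw3 // hw2.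
have h35 : words s3 5 = a by rewrite hw3 // hw2.
have h36 : words s3 6 = z by rewrite hw3 // hw2.
have col3 (x : 'I_n) : x \in S -> words s3 (10 + 4 * x) = c x.
  by move=> xS; rewrite hc3 hc2 E1; [have [] := hh x xS|lia|lia].
have ent3 (x : 'I_n) : x \in S -> entries s3 x.+1 = Some (A x (c x)).
  by move=> xS; rewrite he3 he2 /s1 /=; have [] := hh x xS.
have e30 : entries s3 0 = Some (A a (c z)) by rewrite he3 he2.
set S0 := _ :\ _ in ht3.
have SS0 x : x \in S0 -> x \in S by rewrite !inE => /and3P[].
(* With both extremes removed, reinserting one amounts to dropping the other. *)
have ua : a |: S0 = S :\ z.
  apply/setP => x; rewrite !inE; case: (x =P a) => [->|_] //=.
  by rewrite az aS.
have uz : z |: S0 = S :\ a.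
  apply/setP => x; rewrite !inE; case: (x =P z) => [->|_] //=.
  by rewrite eq_sym az zS.
have ca1 : #|S| = #|S :\ a|.+1 by rewrite (cardsD1 a) aS.
have cz1 : #|S| = #|S :\ z|.+1 by rewrite (cardsD1 z) zS.
apply: wp_seq; apply: (wp_if (v := (A z (c z) <= A a (c z))%O)).
  apply: (eval_test_entry hB) => //; first by rewrite /= h36; lia.
  by rewrite /= h36 addn1 ent3.
(* The query reaches the maximum: [z] returns and [a] is dropped. *)
case: ifP => hyz.
  apply: wp_skip.
  have hhz i : i \in z |: S0 -> holds s3 c i.
    by rewrite uz => /setD1P[_ iS]; split; [exact: col3|exact: ent3].
  apply: wp_conseq (wp_insert h30 ht3 hx3 hhz) _ => s4 t4 q4 [hrep _ htt4 hq4].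
  split; [|move=> /=; lia|lia].
  exists (z |: S0), c; split=> //; last by rewrite uz.
  by rewrite uz; apply: sound_remove_min hs amin zmax hyz.
apply: wp_seq; apply: (wp_store hB); first by rewrite /= h35; lia.
rewrite /= h35; set s4 := State _ _.
have hyz' : (A a (c z) <= A z (c z))%O.
  by case/orP: (Order.TotalTheory.le_total (A a (c z)) (A z (c z))) => //; rewrite hyz.
have h40 : words s4 0 = n by [].
have ht4 b : tree b (words s4) (entries s4) S0.
  by apply: tree_words (ht3 b) _.
apply: (wp_if (v := (A a (c z) <= A a (c a))%O)).
  apply: (eval_test_entry hB) => //; first by rewrite /= h35; lia.
  by rewrite /= h35 addn1 ent3.
(* The query is at most the minimum: [a] returns and [z] is dropped. *)
case: ifP => hya.
  apply: wp_skip.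
  have hha i : i \in a |: S0 -> holds s4 c i.
    by rewrite ua => /setD1P[_ iS]; split; [exact: col3|exact: ent3].
  apply: wp_conseq (wp_insert h40 ht4 erefl hha) _ => s5 t5 q5 [hrep _ htt5 hq5].
  split; [|move=> /=; lia|lia].
  exists (a |: S0), c; split=> //; last by rewrite ua.
  by rewrite ua; apply: sound_remove_max hs amin zmax hya.
have hya' : (A a (c a) <= A a (c z))%O.
  by case/orP: (Order.TotalTheory.le_total (A a (c z)) (A a (c a))) => //; rewrite hya.
(* The query is strictly in between: [a] returns with the queried entry and the column of [z]. *)
apply: wp_seq; apply: (wp_copy hB (x := A a (c z))) => //; first by rewrite /= h35; lia.
rewrite /= h35 addn1.
apply: (wp_store hB); first by rewrite /= h35 h36 col3 //; lia.
rewrite /= h35 h36 (col3 _ zS); set s5 := State _ _.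
(* Slot [a] is in neither tree while its entry changes, so both trees stay correct. *)
have ht5 b : tree b (words s5) (entries s5) S0.
  apply: (tree_entries (E := entries s3)) => [|i].
    apply: tree_words (ht3 b) _ => v v0; rewrite /s5 /=.
    by case: eqP => //; rewrite /node; lia.
  rewrite !inE /s5 /= eqSS => /and3P[_ /negbTE ia _].
  by rewrite val_eqE ia.
have h55 i : i \in a |: S0 -> holds s5 [eta c with a |-> c z] i.
  rewrite ua /holds /s5 /= eqSS val_eqE => /setD1P[_ iS].
  have -> : (10 + 4 * i == 10 + 4 * a) = (i == a) by rewrite -val_eqE /=; lia.
  case: (i =P a) => [->|_]; first by [].
  by split; [exact: col3|exact: ent3].
have h50 : words s5 0 = n by [].
have h52 : words s5 2 = a by [].
apply: wp_conseq (wp_insert h50 ht5 h52 h55) _ => s6 t6 q6 [hrep _ htt6 hq6].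
split; [|move=> /=; lia|lia].
exists (a |: S0), [eta c with a |-> c z]; split=> //; last by rewrite ua.
by rewrite ua; apply: sound_exchange hs aS zS amin zmax az hya' hyz'.
Qed.

Lemma rep_roots s S c : rep s S c -> 0 < #|S| ->
  exists a z : 'I_n, [/\ a \in S /\ z \in S,
    words s 12 = a.+1, words s 13 = z.+1,
    forall x, x \in S -> (A a (c a) <= A x (c x))%O &
    forall x, x \in S -> (A x (c x) <= A z (c z))%O].
Proof.
move=> [_ ht hh] hS.
have [a aS [ha amin]] := tree_root (ht false) hS.
have [z zS [hz zmax]] := tree_root (ht true) hS.
exists a, z; split=> // x xS; have [_ ex] := hh _ xS.
  by move: (amin _ xS); rewrite /better ex; have [_ ->] := hh _ aS.
by move: (zmax _ xS); rewrite /better ex; have [_ ->] := hh _ zS.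
Qed.

Lemma wp_shrink s : 0 < n -> rep s setT id ->
  wp A w shrink s (fun s' t q =>
    [/\ exists (c : 'I_n -> 'I_n) (x : 'I_n),
          [/\ words s' 12 = x.+1, holds s' c x & pseudo_saddlepoint A x (c x)],
        t <= n * (1450 * L) & q <= n.-1]).
Proof.
move=> npos hrep0.
pose J k s := exists S c, [/\ rep s S c, sound S c (A := A) & #|S| = k.+1].
have h0 : J n.-1 s.
  exists setT, id; split=> //; first exact: sound_diagonal.
  by rewrite cardsT card_ord; lia.
have testE s1 (a z : 'I_n) : words s1 12 = a.+1 -> words s1 13 = z.+1 ->
  eval_test w s1 (Not (WordLe (Add (Sub (cell 12) (cell 13))
                                   (Sub (cell 13) (cell 12))) (Lit 0)))
  = Some (a != z).
  move=> h12 h13; have an := ltn_ord a; have zn := ltn_ord z.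
  rewrite /eval_test -/(eval_test w s1 (WordLe _ _)).
  rewrite (eval_test_word hB) /= h12 h13; last by lia.
  by rewrite -val_eqE /=; congr Some; lia.
have step k s1 : J k s1 ->
  eval_test w s1 (Not (WordLe (Add (Sub (cell 12) (cell 13))
                                   (Sub (cell 13) (cell 12))) (Lit 0))) = Some false \/
  exists2 k', k = k'.+1 &
    eval_test w s1 (Not (WordLe (Add (Sub (cell 12) (cell 13))
                                   (Sub (cell 13) (cell 12))) (Lit 0))) = Some true /\
    wp A w round s1 (fun s' t q => [/\ J k' s', t <= 1400 * L & q <= 1]).
  move=> [S [c [hrep hs hk]]].
  have [|a [z [[aS zS] h12 h13 amin zmax]]] := rep_roots hrep; first by rewrite hk.
  rewrite (testE _ _ _ h12 h13); case: (altP (a =P z)) => [_|az] /=; first by left.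
  (* A single remaining slot would be both extremes, against [az]. *)
  right; case: k hk => [|k] hk.
    case/eqP/cards1P: hk aS zS az => x ->; rewrite !inE.
    by move=> /eqP -> /eqP ->; rewrite eqxx.
  exists k => //; split=> //.
  apply: wp_conseq (wp_round hrep hs aS zS az h12 h13 amin zmax) _ => s2 t2 q2.
  move=> [[S' [c' [hrep' hs' hc]]] htt hq]; split=> //; last by rewrite hq.
  by exists S', c'; split=> //; lia.
apply: wp_conseq (wp_while step h0) _ => s1 t q.
move=> [[k [S [c [hrep hs hk]]]] hF htt hqq].
have [|a [z [[aS zS] h12 h13 amin zmax]]] := rep_roots hrep; first by rewrite hk.
(* On exit one slot is both minimal and maximal. *)
move: hF; rewrite (testE _ _ _ h12 h13) => -[/negbFE/eqP az]; subst z.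
split; last by lia.
  exists c, a; split=> //; last exact: sound_pseudo_saddlepoint hs aS amin zmax.
  by case: hrep => _ _; apply.
by move: htt => /=; nia.
Qed.

Lemma wp_output s c (x : 'I_n) : words s 12 = x.+1 -> holds s c x ->
  wp A w output s (fun s' t q => [/\ reports A s' x (c x), t <= 40 & q = 0]).
Proof.
move=> h12 [hc he]; have xn := ltn_ord x; have cn := ltn_ord (c x).
apply: wp_seq; apply: (wp_copy hB (x := A x (c x))).
- by rewrite /= h12; lia.
- by rewrite /= h12.
apply: wp_seq; apply: (wp_store hB); first by rewrite /= h12; lia.
rewrite /= h12 subn1 /=.
apply: wp_seq; apply: (wp_store hB); first by rewrite /= hc; lia.
rewrite /= hc; apply: (wp_store hB); first by rewrite /=; lia.
by split.
Qed.

Lemma wp_saddle : 0 < n ->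
  wp A w saddle (start T n) (fun s t q =>
    [/\ exists i j, reports A s i j /\ pseudo_saddlepoint A i j,
        t <= 2000 * (n * L) & q <= 2 * n - 1]).
Proof.
move=> npos; apply: wp_seq.
apply: wp_conseq (wp_fill npos) _ => s1 t1 q1 [hrep ht1 hq1].
apply: wp_seq; apply: wp_conseq (wp_shrink npos hrep) _ => s2 t2 q2.
move=> [[c [x [h12 hx hp]]] ht2 hq2].
apply: wp_conseq (wp_output h12 hx) _ => s3 t3 q3 [hr ht3 hq3].
split; last by lia.
  by exists x, (c x).
by nia.
Qed.

End Main.

(** * Word length and final bounds *)

Lemma word_fits n : 100 * n <= 2 ^ (8 * bit_length n).
Proof.
have h : n < 2 ^ bit_length n := trunc_log_ltn n (isT : 1 < 2).
(* One [bit_length n] bounds [n]; the other seven give at least [2 ^ 7], which exceeds 100. *)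
rewrite -[8]/(7 + 1) mulnDl mul1n expnD; apply: leq_mul; last exact: ltnW.
by apply: (@leq_trans (2 ^ 7)) => //; rewrite leq_exp2l // leq_pmulr.
Qed.

Theorem theorem9 :
  exists (p : cmd) (b c n0 : nat),
  forall (n : nat) (d : Order.disp_t) (T : orderType d) (A : 'M[T]_n),
    0 < n ->
    exists (s : state T) (t q : nat) (i j : 'I_n),
      [/\ exec A (b * bit_length n) p (start T n) s t q,
          reports A s i j /\ pseudo_saddlepoint A i j,
          q <= 2 * n - 1
        & n0 <= n -> t <= c * (n * trunc_log 2 n)].
Proof.
(* For [n >= 2] the logarithm is at least 1, so adding 1 at most doubles it; hence the threshold 2
   and the doubling of 2000 to 4000. *)
exists saddle, 8, 4000, 2 => n d T A npos.
have [s [t [q [hex [[i [j hij]] ht hq]]]]] := wp_saddle (A := A) (word_fits n) npos.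
exists s, t, q, i, j; split=> // n2.
have := trunc_log_gt0 2 n; rewrite n2 => /idP hL.
apply: leq_trans ht _; rewrite (_ : 4000 = 2000 * 2) // -mulnA leq_pmul2l //.
by rewrite mulnCA leq_pmul2l // mul2n -addnn -addn1 leq_add2l.
Qed.
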